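(* Let $(\mathcal{F}_I,P_I)$ be any of the pairs listed in the context, of type $I\in\{A,B,C,D,E\}$ (for types $C$ and $E$, $\mathcal{F}_I$ is any of the polynomials listed for that type). Fix $\alpha\in\mathbb{C}$ with $P_I(\alpha)\neq0$ and a choice of square root $\sqrt{P_I(\alpha)}$. Then the biquadratic polynomial $$\hat h_I(x_1,x_2)=\frac{\mathcal{F}_I(x_1,x_2,\alpha)}{\sqrt{P_I(\alpha)}}$$ satisfies $$\delta_{x_1}(\hat h_I)=P_I(x_2),\qquad \delta_{x_2}(\hat h_I)=P_I(x_1).$$
   Context: For a polynomial $h(x_1,x_2)$ of degree at most two in each variable (a biquadratic polynomial), and $x\in\{x_1,x_2\}$, define $\delta_x(h)=h_x^2-2h\,h_{xx}$, where subscripts denote partial derivatives. The polynomials $\mathcal{F}_I(x_1,x_2,x_3)\in\mathbb{C}[x_1,x_2,x_3]$ and $P_I(x)\in\mathbb{C}[x]$ are the following. Type A: $P_A(x)=(k^2x^2-1)(x^2-1)$ with four simple zeros ($k\in\mathbb{C}$, $k^2\ne0,1$), and $\mathcal{F}_A=\frac12(-k^2x_1^2-k^2x_2^2+1+k^2x_1^2x_2^2)x_3^2+(1-k^2)x_1x_2x_3+\frac12(x_1^2+x_2^2-k^2x_1^2x_2^2-1)$. Type B: $P_B(x)=x^2-e^2$, $e\in\mathbb{C}$, $e\neq0$, and $\mathcal{F}_B=x_1x_2x_3+\frac e2(x_1^2+x_2^2+x_3^2-e^2)$. Type C: $P_C(x)=x^2$, and $\mathcal{F}_C$ is any of $\mathcal{F}_{C_1}=\lambda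 x_1^2x_2^2+\mu x_1x_2x_3+\nu x_3^2$, $\mathcal{F}_{C_2}=\lambda x_1^2x_3^2+\mu x_1x_2x_3+\nu x_2^2$, $\mathcal{F}_{C_3}=\lambda x_2^2x_3^2+\mu x_1x_2x_3+\nu x_1^2$, $\mathcal{F}_{C_4}=\lambda x_1^2x_2^2x_3^2+\mu x_1x_2x_3+\nu$, with $\lambda,\mu,\nu\in\mathbb{C}$, $\mu^2-4\lambda\nu=1$. Type D: $P_D(x)=x$, and $\mathcal{F}_D=-\frac12(x_1x_2+x_2x_3+x_1x_3)+\frac14(x_1^2+x_2^2+x_3^2)$. Type E: $P_E(x)=1$, and $\mathcal{F}_E$ is any of the polynomials $\lambda s^2+\mu s+\nu$ with $\lambda,\mu,\nu\in\mathbb{C}$, $\mu^2-4\lambda\nu=1$, where $s$ is one of $x_1+x_2+x_3$, $x_2+x_3-x_1$, $x_1+x_3-x_2$, $x_1+x_2-x_3$. *)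

(* Defs.v *)
From HB Require Import structures.
From mathcomp Require Import all_boot all_order all_algebra.
From mathcomp Require Export mpoly complex reals.

Set Implicit Arguments.
Unset Strict Implicit.
Unset Printing Implicit Defensive.

Import GRing.Theory.
Local Open Scope ring_scope.

Definition biquadratic (K : nzRingType) (n : nat) (h : {mpoly K[n]}) : Prop :=
  forall m : 'X_{1..n}, m \in msupp h -> forall i : 'I_n, (m i <= 2)%N.

Definition delta (K : nzRingType) (n : nat) (i : 'I_n) (h : {mpoly K[n]})
  : {mpoly K[n]} :=
  mderiv i h ^+ 2 - 2%:R * h * mderiv i (mderiv i h).

Definition at_var (K : nzRingType) (n : nat) (P : {poly K}) (i : 'I_n)
  : {mpoly K[n]} :=
  (map_poly (@mpolyC n K) P).['X_i].

(* The variables x_1, x_2, ... have the indices 0, 1, ... in 'I_n. *)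
Definition i2_1 : 'I_2 := @Ordinal 2 0 isT.
Definition i2_2 : 'I_2 := @Ordinal 2 1 isT.
Definition i3_1 : 'I_3 := @Ordinal 3 0 isT.
Definition i3_2 : 'I_3 := @Ordinal 3 1 isT.
Definition i3_3 : 'I_3 := @Ordinal 3 2 isT.

Section CanonicalPairs.

Variable K : fieldType.

Local Notation x1 := ('X_i3_1 : {mpoly K[3]}).
Local Notation x2 := ('X_i3_2 : {mpoly K[3]}).
Local Notation x3 := ('X_i3_3 : {mpoly K[3]}).

Definition PA (k : K) : {poly K} := ((k ^+ 2)%:P * 'X^2 - 1) * ('X^2 - 1).

Definition FA (k : K) : {mpoly K[3]} :=
  2^-1 *: (- (k ^+ 2) *: x1 ^+ 2 - k ^+ 2 *: x2 ^+ 2 + 1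
           + k ^+ 2 *: (x1 ^+ 2 * x2 ^+ 2)) * x3 ^+ 2
  + (1 - k ^+ 2) *: (x1 * x2 * x3)
  + 2^-1 *: (x1 ^+ 2 + x2 ^+ 2 - k ^+ 2 *: (x1 ^+ 2 * x2 ^+ 2) - 1).

Definition PB (e : K) : {poly K} := 'X^2 - (e ^+ 2)%:P.

Definition FB (e : K) : {mpoly K[3]} :=
  x1 * x2 * x3
  + (e / 2) *: (x1 ^+ 2 + x2 ^+ 2 + x3 ^+ 2 - (e ^+ 2)%:MP).

Definition PC : {poly K} := 'X^2.

Definition FC1 (l m n : K) : {mpoly K[3]} :=
  l *: (x1 ^+ 2 * x2 ^+ 2) + m *: (x1 * x2 * x3) + n *: x3 ^+ 2.

Definition FC2 (l m n : K) : {mpoly K[3]} :=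
  l *: (x1 ^+ 2 * x3 ^+ 2) + m *: (x1 * x2 * x3) + n *: x2 ^+ 2.

Definition FC3 (l m n : K) : {mpoly K[3]} :=
  l *: (x2 ^+ 2 * x3 ^+ 2) + m *: (x1 * x2 * x3) + n *: x1 ^+ 2.

Definition FC4 (l m n : K) : {mpoly K[3]} :=
  l *: (x1 ^+ 2 * x2 ^+ 2 * x3 ^+ 2) + m *: (x1 * x2 * x3) + n%:MP.

Definition PD : {poly K} := 'X.

Definition FD : {mpoly K[3]} :=
  - (2^-1 *: (x1 * x2 + x2 * x3 + x1 * x3))
  + 4^-1 *: (x1 ^+ 2 + x2 ^+ 2 + x3 ^+ 2).

Definition PE : {poly K} := 1.

Definition FE (s : {mpoly K[3]}) (l m n : K) : {mpoly K[3]} :=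
  l *: s ^+ 2 + m *: s + n%:MP.

Inductive canonical_pair : {mpoly K[3]} -> {poly K} -> Prop :=
| TypeA k : k ^+ 2 <> 0 -> k ^+ 2 <> 1 -> canonical_pair (FA k) (PA k)
| TypeB e : e <> 0 -> canonical_pair (FB e) (PB e)
| TypeC1 l m n : m ^+ 2 - 4 * l * n = 1 -> canonical_pair (FC1 l m n) PC
| TypeC2 l m n : m ^+ 2 - 4 * l * n = 1 -> canonical_pair (FC2 l m n) PC
| TypeC3 l m n : m ^+ 2 - 4 * l * n = 1 -> canonical_pair (FC3 l m n) PC
| TypeC4 l m n : m ^+ 2 - 4 * l * n = 1 -> canonical_pair (FC4 l m n) PC
| TypeD : canonical_pair FD PD
| TypeE s l m n :
    s \in [:: x1 + x2 + x3; x2 + x3 - x1; x1 + x3 - x2; x1 + x2 - x3] ->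
    m ^+ 2 - 4 * l * n = 1 -> canonical_pair (FE s l m n) PE.

(* The argument r is to be a square root of P(a). *)
Definition hhat (F : {mpoly K[3]}) (a r : K) : {mpoly K[2]} :=
  r^-1 *: comp_mpoly [tuple 'X_i2_1; 'X_i2_2; a%:MP] F.

End CanonicalPairs.

(* Main.v *)
(* Each F is quadratic in every variable, and for h = a x^2 + b x + c with
   a, b, c free of x, delta_x h is the discriminant b^2 - 4 a c. The discriminant of F
   in x_i factors as P(x_j) P(x_k); specialising x_3 = alpha and dividing by
   r^2 = P(alpha) leaves the other factor. *)
Require Import Defs.
From mathcomp Require Import all_boot all_order all_algebra ring zify.
Import GRing.Theory Num.Theory.
Local Open Scope ring_scope.

(** * Evaluation of univariate polynomials at a variable *)

Lemma at_varC (K : nzRingType) (n : nat) (c : K) (i : 'I_n) :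
  at_var c%:P i = c%:MP.
Proof. by rewrite /at_var map_polyC hornerC. Qed.

Lemma at_varX (K : nzRingType) (n : nat) (i : 'I_n) :
  at_var 'X i = 'X_i :> {mpoly K[n]}.
Proof. by rewrite /at_var map_polyX hornerX. Qed.

Lemma at_varD (K : nzRingType) (n : nat) (i : 'I_n) (p q : {poly K}) :
  at_var (p + q) i = at_var p i + at_var q i.
Proof. by rewrite /at_var rmorphD hornerD. Qed.

Lemma at_varN (K : nzRingType) (n : nat) (i : 'I_n) (p : {poly K}) :
  at_var (- p) i = - at_var p i.
Proof. by rewrite /at_var rmorphN hornerN. Qed.

Lemma at_varM (K : comNzRingType) (n : nat) (i : 'I_n) (p q : {poly K}) :
  at_var (p * q) i = at_var p i * at_var q i.
Proof. by rewrite /at_var rmorphM hornerM. Qed.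

Lemma at_varXn (K : comNzRingType) (n : nat) (i : 'I_n) (p : {poly K}) k :
  at_var (p ^+ k) i = at_var p i ^+ k.
Proof. by rewrite /at_var rmorphXn horner_exp. Qed.

Definition at_varE := (at_varD, at_varN, at_varM, at_varXn, at_varX, at_varC).

Lemma mderiv_at_var (K : comNzRingType) (n : nat) (i j : 'I_n) (p : {poly K}) :
  i != j -> mderiv i (at_var p j) = 0.
Proof.
move=> ij; elim/poly_ind: p => [|p c IHp].
  by rewrite /at_var rmorph0 horner0 mderiv0.
rewrite at_varD at_varM at_varX at_varC mderivD mderivM mderivC IHp mderivX.
by rewrite mnmE eq_sym (negPf ij) scale0r !(mul0r, mulr0, addr0).
Qed.

(** * Derivatives, discriminant and degree of quadratics in one variable *)

Lemma mderivXU (K : nzRingType) (n : nat) (i : 'I_n) :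
  mderiv i 'X_i = 1 :> {mpoly K[n]}.
Proof.
rewrite mderivX mnm1E eqxx scale1r -mpolyX0; congr 'X_[_].
by apply/mnmP => j; rewrite mnmBE subnn mnm0E.
Qed.

Lemma mderiv_quadratic (K : comNzRingType) (n : nat) (i : 'I_n)
    (a b c : {mpoly K[n]}) :
  mderiv i a = 0 -> mderiv i b = 0 -> mderiv i c = 0 ->
  mderiv i (a * 'X_i ^+ 2 + b * 'X_i + c) = 2 * a * 'X_i + b.
Proof.
move=> a0 b0 c0.
by rewrite expr2 !(mderivD, mderivM) a0 b0 c0 mderivXU; ring.
Qed.

Lemma mderiv2_quadratic (K : comNzRingType) (n : nat) (i : 'I_n)
    (a b c : {mpoly K[n]}) :
  mderiv i a = 0 -> mderiv i b = 0 -> mderiv i c = 0 ->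
  mderiv i (mderiv i (a * 'X_i ^+ 2 + b * 'X_i + c)) = 2 * a.
Proof.
move=> a0 b0 c0; rewrite mderiv_quadratic // mderivD -mulrA mderivM.
by rewrite -mpolyC_nat mderivC mderivM a0 b0 mderivXU; ring.
Qed.

Lemma delta_quadratic (K : comNzRingType) (n : nat) (i : 'I_n)
    (a b c : {mpoly K[n]}) :
  mderiv i a = 0 -> mderiv i b = 0 -> mderiv i c = 0 ->
  delta i (a * 'X_i ^+ 2 + b * 'X_i + c) = b ^+ 2 - 4 * a * c.
Proof.
move=> a0 b0 c0; rewrite /delta mderiv2_quadratic // mderiv_quadratic //.
ring.
Qed.

Lemma deltaZ (K : comNzRingType) (n : nat) (i : 'I_n) (k : K)
    (h : {mpoly K[n]}) :
  delta i (k *: h) = k ^+ 2 *: delta i h.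
Proof. by rewrite /delta !mderivZ -!mul_mpolyC rmorphXn /=; ring. Qed.

(* In characteristic 0 a vanishing third derivative bounds the degree. *)
Lemma msupp_quadratic (K : numDomainType) (n : nat) (i : 'I_n)
    (a b c : {mpoly K[n]}) :
  mderiv i a = 0 -> mderiv i b = 0 -> mderiv i c = 0 ->
  forall m : 'X_{1..n},
    m \in msupp (a * 'X_i ^+ 2 + b * 'X_i + c) -> (m i <= 2)%N.
Proof.
move=> a0 b0 c0 m; set h := (X in msupp X) => mh; rewrite leqNgt.
have h3 : mderiv i (mderiv i (mderiv i h)) = 0.
  rewrite mderiv2_quadratic //.
  by rewrite -mpolyC_nat mderivM mderivC a0 mul0r mulr0 addr0.
apply/negP => m3; move: mh; rewrite mcoeff_msupp => /eqP; apply.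
(* This coefficient of the third derivative is a nonzero integer multiple of the coefficient of [m]
   in [h]. The truncated subtraction loses nothing because [m i] is at least 3. *)
have /(congr1 (mcoeff (m - U_(i) *+ 3))) := h3.
rewrite !mcoeff_deriv mcoeff0.
have -> : (m - U_(i) *+ 3 + U_(i) + U_(i) + U_(i) = m)%MM.
  apply/mnmP => j; rewrite !(mnmDE, mnmBE, mulmnE, mnm1E).
  by case: eqVneq => [<-|_] /=; lia.
by move/eqP; rewrite !mulrn_eq0 /= => /eqP.
Qed.

(** Reduces each type to two expansions and two discriminant identities. The coefficients are
    univariate in the other variable, so the discriminants are computed in [{poly K}]; [v] lets each
    case supply P(alpha) in explicit form. *)
Lemma hhat_of_quadratics (K : numFieldType) (F : {mpoly K[3]})
    (P a b c a' b' c' : {poly K}) (alpha r v : K) :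
  P.[alpha] <> 0 -> r ^+ 2 = P.[alpha] -> P.[alpha] = v ->
  let G := comp_mpoly [tuple 'X_i2_1; 'X_i2_2; alpha%:MP] F in
  G = at_var a i2_2 * 'X_i2_1 ^+ 2 + at_var b i2_2 * 'X_i2_1
      + at_var c i2_2 ->
  G = at_var a' i2_1 * 'X_i2_2 ^+ 2 + at_var b' i2_1 * 'X_i2_2
      + at_var c' i2_1 ->
  b ^+ 2 - 4%:P * a * c = v%:P * P ->
  b' ^+ 2 - 4%:P * a' * c' = v%:P * P ->
  biquadratic (hhat F alpha r) /\
  delta i2_1 (hhat F alpha r) = at_var P i2_2 /\
  delta i2_2 (hhat F alpha r) = at_var P i2_1.
Proof.
move=> Pa r2 Pv G GE1 GE2 disc1 disc2; rewrite /hhat -/G.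
(* [delta] is homogeneous of degree 2, so the factor 1/r contributes 1/r^2 = 1/v, which cancels
   [v]. *)
have norm (i : 'I_2) d : d = v%:P * P ->
    r^-1 ^+ 2 *: at_var d i = at_var P i.
  move=> ->; rewrite at_varM at_varC mul_mpolyC scalerA exprVn r2 -Pv.
  by rewrite mulVf ?scale1r //; apply/eqP.
have disc i (p q s : {poly K}) :
    at_var q i ^+ 2 - 4 * at_var p i * at_var s i
    = at_var (q ^+ 2 - 4%:P * p * s) i :> {mpoly K[2]}.
  by rewrite !at_varE mpolyC_nat.
split; last first.
  by rewrite !deltaZ {1}GE1 GE2 !delta_quadratic ?mderiv_at_var //
    !disc !norm.
move=> m /msuppZ_le mG i.
have [->|->] : i = i2_1 \/ i = i2_2.
  by case: i => [[|[|//]] ?]; [left|right]; apply/val_inj.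
- by apply: (@msupp_quadratic _ _ _ (at_var a i2_2) (at_var b i2_2)
    (at_var c i2_2)); rewrite ?mderiv_at_var // -GE1.
- by apply: (@msupp_quadratic _ _ _ (at_var a' i2_1) (at_var b' i2_1)
    (at_var c' i2_1)); rewrite ?mderiv_at_var // -GE2.
Qed.

(** * Substitution of alpha for x_3 and verification type by type *)

Lemma comp_mpolyM (K : comNzRingType) (n k : nat)
    (lq : n.-tuple {mpoly K[k]}) (p q : {mpoly K[n]}) :
  comp_mpoly lq (p * q) = comp_mpoly lq p * comp_mpoly lq q.
Proof. exact: rmorphM. Qed.

Lemma comp_mpolyXn (K : comNzRingType) (n k : nat)
    (lq : n.-tuple {mpoly K[k]}) (p : {mpoly K[n]}) (d : nat) :
  comp_mpoly lq (p ^+ d) = comp_mpoly lq p ^+ d.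
Proof. exact: rmorphXn. Qed.

Definition comp_mpoly3E := (comp_mpolyD, comp_mpolyN, comp_mpolyM,
  comp_mpolyXn, comp_mpolyC, comp_mpoly1, comp_mpolyXU).

(** Scalings are first turned into products with constants, so that substitution leaves a plain ring
    identity. *)
Ltac expand_mpoly := by rewrite -?mul_mpolyC ?comp_mpoly3E ?at_varE /=; ring.

Lemma canonical_pair_hhat (K : numFieldType) (F : {mpoly K[3]}) (P : {poly K})
    (alpha r : K) :
  canonical_pair F P -> P.[alpha] <> 0 -> r ^+ 2 = P.[alpha] ->
  biquadratic (hhat F alpha r) /\
  delta i2_1 (hhat F alpha r) = at_var P i2_2 /\
  delta i2_2 (hhat F alpha r) = at_var P i2_1.
Proof.
(* With 4 * 1/2 * 1/2 = 1 brought in explicitly, the rest is an identity in which 1/2 may be an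
   indeterminate. *)
have disc_half (b a c : {poly K}) :
    b ^+ 2 - 4%:P * ((2^-1)%:P * a) * ((2^-1)%:P * c) = b ^+ 2 - a * c.
  have half : 4%:P * (2^-1)%:P * (2^-1)%:P = 1 :> {poly K}.
    by rewrite -!polyCM (_ : 4 * 2^-1 * 2^-1 = 1) //; field.
  by rewrite -[a * c]mul1r -half; ring.
(* The constraint is lifted to [{poly K}] and solved for the monomial mu^2, ready for [ring: D]. *)
have discE (l m n : K) : m ^+ 2 - 4 * l * n = 1 ->
    m%:P ^+ 2 = 1 + 4 * l%:P * n%:P :> {poly K}.
  by move=> /eqP; rewrite subr_eq -polyC_exp => /eqP ->; ring.
case=> [k _ _|e _|l m n /discE D|l m n /discE D|l m n /discE D|l m n /discE D
  ||s l m n sE /discE D] Pa r2.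
(* The coefficients of x_1^2, x_1 and 1 at x_3 = alpha. F_A is symmetric in x_1 and x_2, so one
   triple serves both variables. *)
- pose a := (2^-1)%:P * (1 - (k ^+ 2)%:P * 'X^2
    - (k ^+ 2 * alpha ^+ 2)%:P * (1 - 'X^2)).
  pose b := ((1 - k ^+ 2) * alpha)%:P * 'X.
  pose c := (2^-1)%:P * ('X^2 + (alpha ^+ 2)%:P
    - (k ^+ 2 * alpha ^+ 2)%:P * 'X^2 - 1).
  apply: (hhat_of_quadratics _ _ _ a b c a b c _ _
    ((k ^+ 2 * alpha ^+ 2 - 1) * (alpha ^+ 2 - 1)) Pa r2); rewrite /a /b /c.
  + by rewrite /PA !hornerE; ring.
  + by rewrite /FA; expand_mpoly.
  + by rewrite /FA; expand_mpoly.
  + by rewrite disc_half /PA; ring.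
  + by rewrite disc_half /PA; ring.
- pose a := (2^-1)%:P * e%:P : {poly K}.
  pose b := alpha%:P * 'X.
  pose c := (2^-1)%:P * (e%:P * ('X^2 + (alpha ^+ 2 - e ^+ 2)%:P)).
  apply: (hhat_of_quadratics _ _ _ a b c a b c _ _
    (alpha ^+ 2 - e ^+ 2) Pa r2); rewrite /a /b /c.
  + by rewrite /PB !hornerE; ring.
  + by rewrite /FB; expand_mpoly.
  + by rewrite /FB; expand_mpoly.
  + by rewrite disc_half /PB; ring.
  + by rewrite disc_half /PB; ring.
- pose a := l%:P * 'X^2.
  pose b := (m * alpha)%:P * 'X.
  pose c := (n * alpha ^+ 2)%:P : {poly K}.
  apply: (hhat_of_quadratics _ _ _ a b c a b c _ _
    (alpha ^+ 2) Pa r2); rewrite /a /b /c.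
  + by rewrite /PC !hornerE; ring.
  + by rewrite /FC1; expand_mpoly.
  + by rewrite /FC1; expand_mpoly.
  + by rewrite /PC; ring: D.
  + by rewrite /PC; ring: D.
(* No symmetry here: seen from x_2 the leading coefficient is nu, and the x_1^2 term becomes the
   constant one. Type C3 exchanges the two triples. *)
- pose a := (l * alpha ^+ 2)%:P : {poly K}.
  pose b := (m * alpha)%:P * 'X.
  pose c := n%:P * 'X^2.
  apply: (hhat_of_quadratics _ _ _ a b c n%:P b (a * 'X^2) _ _
    (alpha ^+ 2) Pa r2); rewrite /a /b /c.
  + by rewrite /PC !hornerE; ring.
  + by rewrite /FC2; expand_mpoly.
  + by rewrite /FC2; expand_mpoly.
  + by rewrite /PC; ring: D.
  + by rewrite /PC; ring: D.
- pose a := (l * alpha ^+ 2)%:P : {poly K}.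
  pose b := (m * alpha)%:P * 'X.
  pose c := n%:P * 'X^2.
  apply: (hhat_of_quadratics _ _ _ n%:P b (a * 'X^2) a b c _ _
    (alpha ^+ 2) Pa r2); rewrite /a /b /c.
  + by rewrite /PC !hornerE; ring.
  + by rewrite /FC3; expand_mpoly.
  + by rewrite /FC3; expand_mpoly.
  + by rewrite /PC; ring: D.
  + by rewrite /PC; ring: D.
- pose a := (l * alpha ^+ 2)%:P * 'X^2.
  pose b := (m * alpha)%:P * 'X.
  apply: (hhat_of_quadratics _ _ _ a b n%:P a b n%:P _ _
    (alpha ^+ 2) Pa r2); rewrite /a /b.
  + by rewrite /PC !hornerE; ring.
  + by rewrite /FC4; expand_mpoly.
  + by rewrite /FC4; expand_mpoly.
  + by rewrite /PC; ring: D.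
  + by rewrite /PC; ring: D.
(* All fractions are expressed through 1/4, whose only relation needed is 16 * 1/4 * 1/4 = 1. *)
- have half_quarter : 2^-1 = 2 * 4^-1 :> K by field.
  have quarter : 16%:P * (4^-1)%:P * (4^-1)%:P = 1 :> {poly K}.
    by rewrite -!polyCM (_ : 16 * 4^-1 * 4^-1 = 1) //; field.
  pose a := (4^-1)%:P : {poly K}.
  pose b := - (2%:P * (4^-1)%:P * ('X + alpha%:P)).
  pose c := (4^-1)%:P * ('X - alpha%:P) ^+ 2.
  apply: (hhat_of_quadratics _ _ _ a b c a b c _ _
    alpha Pa r2); rewrite /a /b /c.
  + by rewrite /PD !hornerE; ring.
  + by rewrite /FD half_quarter; expand_mpoly.
  + by rewrite /FD half_quarter; expand_mpoly.
  + by rewrite /PD -[RHS]mul1r -quarter; ring.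
  + by rewrite /PD -[RHS]mul1r -quarter; ring.
(* The four linear forms differ only in signs, so they are treated together with sign parameters. *)
have [e1 [e2 [e3 [sE' e1E e2E]]]] : exists e1 e2 e3 : K,
    [/\ s = e1%:MP * 'X_i3_1 + e2%:MP * 'X_i3_2 + e3%:MP * 'X_i3_3,
         e1 ^+ 2 = 1 & e2 ^+ 2 = 1].
  move: sE; rewrite !inE => /or4P[] /eqP ->.
  - by exists 1, 1, 1; split; ring.
  - by exists (-1), 1, 1; split; ring.
  - by exists 1, (-1), 1; split; ring.
  - by exists 1, 1, (-1); split; ring.
have {}e1E : e1%:P ^+ 2 = 1 :> {poly K} by rewrite -polyC_exp e1E.
have {}e2E : e2%:P ^+ 2 = 1 :> {poly K} by rewrite -polyC_exp e2E.
(* At x_3 = alpha, s = e_1 x_1 + (w e_2)(x_2) = e_2 x_2 + (w e_1)(x_1). *)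
pose w (e : K) := e%:P * 'X + (e3 * alpha)%:P.
(* With q(t) = lambda t^2 + mu t + nu, these are q'(w) and q(w), from the Taylor expansion of q at
   w. Translation preserves the discriminant mu^2 - 4 lambda nu = 1, and the sign enters only
   squared. *)
pose b (e : K) := 2%:P * l%:P * w e + m%:P.
pose c (e : K) := l%:P * w e ^+ 2 + m%:P * w e + n%:P.
apply: (hhat_of_quadratics _ _ _ (l * e1 ^+ 2)%:P (e1%:P * b e2) (c e2)
  (l * e2 ^+ 2)%:P (e2%:P * b e1) (c e1) _ _ 1 Pa r2); rewrite /b /c /w.
+ by rewrite /PE !hornerE; ring.
+ by rewrite /FE sE'; expand_mpoly.
+ by rewrite /FE sE'; expand_mpoly.
+ by rewrite /PE; ring: D e1E e2E.
+ by rewrite /PE; ring: D e1E e2E.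
Qed.

Theorem proposition1 (R : realType) (F : {mpoly R[i][3]}) (P : {poly R[i]})
    (alpha r : R[i]) (hFP : canonical_pair F P)
    (halpha : P.[alpha] <> 0) (hr : r ^+ 2 = P.[alpha]) :
  biquadratic (hhat F alpha r) /\
  delta i2_1 (hhat F alpha r) = at_var P i2_2 /\
  delta i2_2 (hhat F alpha r) = at_var P i2_1.
Proof. exact: canonical_pair_hhat hFP halpha hr. Qed.
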